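(* Let $(E,\|\cdot\|)$ be a Banach space and let $f,g:E\to\mathbb{R}\cup\{+\infty\}$ be proper and lower semicontinuous functions. Let $c,\delta>0$ and let $\bar x\in \mathrm{plr}_{c,\delta}f\cap \mathrm{plr}_{c,\delta}g\cap \mathrm{dom}\, f$. Suppose that $$\partial f(x)=\partial g(x),\qquad \forall x\in B^\circ(\bar x;\delta).$$ Then there is a constant $a\in\mathbb{R}$ such that $$f(x)=g(x)+a,\qquad \forall x\in B^\circ(\bar x;\hat\delta),$$ where $\hat\delta:=\min\left\{\frac{\delta}{2},\frac{1}{18c}\right\}$.
   Context: $E$ is a (real) Banach space with dual $E^*$ (with the dual norm) and closed unit ball $B_E$; $B^\circ(x;\delta)$ is the open ball with centre $x$ and radius $\delta$. For $f:E\to\mathbb{R}\cup\{+\infty\}$, $\mathrm{dom}\, f=\{x: f(x)<+\infty\}$, and $f$ is proper if $\mathrm{dom}\, f\neq\varnothing$. Clarke-Rockafellar subdifferential: for lower semicontinuous $f$, $x\in\mathrm{dom}\, f$ and $h\in E$, put $$f^\circ(x;h):=\sup_{\varepsilon>0}f^\circ_\varepsilon(x;h),\qquad f^\circ_\varepsilon(x;h):=\limsup_{y\to_f x,\ t\searrow0}\frac{\inf f(y+t(h+\varepsilon B_E))-f(y)}{t},$$ where $y\to_f x$ means $y\to x$ and $f(y)\to f(x)$, and $\inf f(A)$ is the infimum of $f$ over the set $A$. Then $\partial f(x):=\{p\in E^*: p(h)\le f^\circ(x;h)\ \forall h\in E\}$ for $x\in\mathrm{dom}\, f$, and $\partial f(x):=\varnothing$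 if $f(x)=+\infty$. Primal lower regularity: for a proper lower semicontinuous $f$, $c>0$ and $\delta>0$, one writes $\bar x\in\mathrm{plr}_{c,\delta}f$ if $$f(y)\ge f(x)+p(y-x)-c(1+\|p\|)\|y-x\|^2$$ for all $x,y\in B^\circ(\bar x;\delta)$ and all $p\in\partial f(x)$. *)

(* Defs.v *)
From HB Require Import structures.
From mathcomp Require Import all_boot all_order all_algebra.
From mathcomp Require Import all_classical all_reals all_analysis.

Set Implicit Arguments.
Unset Strict Implicit.
Unset Printing Implicit Defensive.

Import Order.TTheory GRing.Theory Num.Theory.
Import numFieldNormedType.Exports.

Local Open Scope classical_set_scope.
Local Open Scope ring_scope.

(* Functions E -> R u {+oo} are represented by f : E -> \bar R; that f never
   takes the value -oo is a separate hypothesis. *)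

Section clarke_rockafellar.
Context {R : realType} {E : normedModType R}.
Implicit Types (f : E -> \bar R) (x h : E).

Definition edom f : set E := [set x | (f x < +oo)%E].

Definition proper_fun f : Prop := edom f !=set0.

(* The filter of y -> x with f y -> f x, generated by the sets
   U `&` f @^-1` V where U and V are neighbourhoods of x and f x. *)
Definition graph_nbhs f x : set_system E :=
  filter_from (fun UV : set E * set \bar R => nbhs x UV.1 /\ nbhs (f x) UV.2)
    (fun UV => UV.1 `&` f @^-1` UV.2).

Definition cr_eps_deriv f (e : R) x h : \bar R :=
  limf_esup (fun yt : E * R =>
      (ereal_inf [set f (yt.1 + yt.2 *: (h + e *: b))%R | b in closed_ball (0 : E)%R 1%R]
        - f yt.1) * (yt.2^-1)%R%:E)%E
    (filter_prod (graph_nbhs f x) 0^'+).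

Definition cr_deriv f x h : \bar R :=
  ereal_sup [set cr_eps_deriv f e x h | e in [set e : R | 0 < e]].

(* Elements of the dual are the continuous p : {linear E -> R^o}. *)
Definition subdiff f x : set {linear E -> R^o} :=
  [set p : {linear E -> R^o} |
    [/\ edom f x, continuous p & forall h, ((p h)%:E <= cr_deriv f x h)%E]].

(* The real-valued sup is meaningful here for continuous p only. *)
Definition dual_norm (p : {linear E -> R^o}) : R :=
  sup [set `|p h| | h in closed_ball (0 : E) 1].

Definition plr (c delta : R) f : set E :=
  [set x0 | forall x y, ball x0 delta x -> ball x0 delta y ->
    forall p, subdiff f x p ->
    (f x + (p (y - x))%:E - (c * (1 + dual_norm p) * `|y - x| ^+ 2)%:E
      <= f y)%E].

End clarke_rockafellar.

(* Main.v *)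
Require Import Defs.
From HB Require Import structures.
From mathcomp Require Import all_boot all_order all_algebra.
From mathcomp Require Import all_classical all_reals all_analysis.
From mathcomp Require Import ring lra.
Import Order.TTheory GRing.Theory Num.Theory.
Import numFieldNormedType.Exports.
Local Open Scope classical_set_scope.
Local Open Scope ring_scope.

(** The subdifferential determines f because f can be recovered from it along
descending chains.

Fix a point [a] near [x0] where [f] has a subgradient.  Lower regularity of [f]
at [a] makes [F := f + K |. - a|], for large [K], grow linearly away from [a];
put [G := g + K |. - a|].  From a point [x] with a subgradient, take proximal
steps for [F]: the next point minimizes [F + |. - x|^2 / (2 lam)], up to a small
Ekeland perturbation.  Let [s] and [d] be the lengths of two successive steps.
The optimality condition produces at each new point [v] a subgradient [p] of [f]
such that [p] plus a slope of [K |. - a|] has size about [d / lam] and points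
back to [x].  As [p] is also a subgradient of [g] at [v], lower regularity gives,
up to terms of higher order,

  [F x - F v <= s d / lam]   and   [G x - G v >= d^2 / lam],

the first from the subgradient at [x], the second from the one at [v].  By
Young's inequality [s d - d^2 <= (s^2 - d^2) / 2], and the right-hand side
telescopes along the chain ([descent_comparison]).  For large [K] the slope of
[F] is bounded below off [a], so every step that does not end at [a] has length
at least [lam], and the chain reaches [a] after finitely many steps.  Hence
[F x - F a <= G x - G a + o(1)] as [lam] tends to [0], that is
[f x - f a <= g x - g a] ([subdiff_increment_le]); exchanging [f] and [g] gives
equality.  Points without a subgradient are reached by density of the domain of
the subdifferential and lower semicontinuity ([plr_le_shift]).

The optimality condition is an exact Fermat rule for the sum of a lower
semicontinuous function and a continuous convex one ([subdiff_local_min]).  It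
rests on the convexity of the Clarke-Rockafellar derivative in its direction
([cr_bound_convex]) and on a Hahn-Banach theorem stated for convex subsets of
[V * R] ([convex_graph_linear_minorant]); minimizers come from Ekeland's
variational principle ([ekeland]). *)

(** * A Hahn-Banach theorem *)

Definition convex_graph {R : realType} {V : lmodType R} (A : set (V * R)) :=
  forall x y r s (a b : R), 0 <= a -> 0 <= b -> a + b = 1 ->
    A (x, r) -> A (y, s) -> A (a *: x + b *: y, a * r + b * s).

Definition nonneg_at0 {R : realType} {V : lmodType R} (A : set (V * R)) :=
  forall r, A (0, r) -> 0 <= r.

(** Zorn's lemma applies because both properties pass to unions of chains.
Enlarging a set amounts to lowering its lower boundary, so a maximal set is the
epigraph of a minimal convex function. *)
Lemma convex_graph_maximal {R : realType} {V : lmodType R} (A : set (V * R)) :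
  convex_graph A -> nonneg_at0 A ->
  exists M, [/\ A `<=` M, convex_graph M, nonneg_at0 M &
    forall C, M `<=` C -> convex_graph C -> nonneg_at0 C -> C `<=` M].
Proof.
move=> Acvx A0.
pose P B := convex_graph (A `|` B) /\ nonneg_at0 (A `|` B).
have [F FP Ftot|B [[Bcvx B0] Bmax]] := @Zorn_bigcup _ P.
  split; last first.
    by move=> r [/A0//|[X FX Xr]]; have [_ X0] := FP X FX; apply: X0; right.
  have chain X x r Y y s (a b : R) : 0 <= a -> 0 <= b -> a + b = 1 ->
      F X -> F Y -> (A `|` X) (x, r) -> (A `|` Y) (y, s) ->
      (A `|` \bigcup_(X in F) X) (a *: x + b *: y, a * r + b * s).
    move=> a0 b0 ab FX FY AX AY.
    have [Z FZ [XZ YZ]] : exists2 Z, F Z & X `<=` Z /\ Y `<=` Z.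
      by have [XY|YX] := Ftot X Y FX FY; [exists Y => //; split|exists X => //; split].
    have [Zcvx _] := FP Z FZ; have [||?|?] := Zcvx x y r s a b a0 b0 ab.
    - by case: AX => [|/XZ]; [left|right].
    - by case: AY => [|/YZ]; [left|right].
    - by left.
    - by right; exists Z.
  move=> x y r s a b a0 b0 ab [Ax|[X FX Xx]] [Ay|[Y FY Yy]].
  - by left; exact: Acvx.
  - by apply: (chain Y _ _ Y) => //; [left|right].
  - by apply: (chain X _ _ X) => //; [right|left].
  - by apply: (chain X _ _ Y) => //; right.
exists (A `|` B); split=> // C ABC Ccvx C0.
have AC : A `|` C = C by apply/setUidPr => z Az; apply: ABC; left.
have CB : C `<=` B.
  apply: contrapT => CB; apply: (Bmax C).
    by split => // z Bz; apply: ABC; right.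
  by rewrite /P AC.
by move=> z /CB; right.
Qed.

(** Hahn-Banach without partially defined functionals: the lower boundary [q] of
a maximal convex set containing [A] is a minimal convex function with
[0 <= q 0], and minimality makes it linear.  Each of [q 0 = 0], homogeneity and
additivity is obtained by exhibiting a competing set built from [q]. *)
Theorem convex_graph_linear_minorant {R : realType} {V : lmodType R}
    (A : set (V * R)) :
  convex_graph A -> nonneg_at0 A -> (forall h, exists r, A (h, r)) ->
  exists p : {linear V -> R^o}, forall h r, A (h, r) -> p h <= r.
Proof.
move=> Acvx A0 Adom.
have [M [AM Mcvx M0 Mmax]] := @convex_graph_maximal R V A Acvx A0.
have Mdom h : exists r, M (h, r) by have [r /AM] := Adom h; exists r.
pose q h : R := inf [set r | M (h, r)].
have Mlb h : has_lbound [set r | M (h, r)].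
  have [s Ms] := Mdom (- h); exists (- s) => r /= Mr.
  have /M0 : M (0, 2^-1 * r + 2^-1 * s).
    have -> : 0 = 2^-1 *: h + 2^-1 *: (- h) by rewrite scalerN subrr.
    by apply: Mcvx => //; lra.
  by lra.
have qle h r : M (h, r) -> q h <= r by move=> Mr; apply: ge_inf.
have qadh h e : 0 < e -> exists2 r, M (h, r) & r < q h + e.
  move=> e0; have Hi : has_inf [set r | M (h, r)] by split; [exact: Mdom|exact: Mlb].
  by have [r] := inf_adherent e0 Hi; exists r.
have q0_ge0 : 0 <= q 0 by apply: lb_le_inf => //; exact: Mdom.
have qcvx x y (a b : R) : 0 <= a -> 0 <= b -> a + b = 1 ->
    q (a *: x + b *: y) <= a * q x + b * q y.
  move=> a0 b0 ab; apply/ler_addgt0Pr => e e0.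
  have [r Mr re] := qadh x e e0; have [s Ms se] := qadh y e e0.
  apply: (le_trans (qle _ _ (Mcvx _ _ _ _ _ _ a0 b0 ab Mr Ms))).
  have : a * r <= a * (q x + e) by rewrite ler_wpM2l// ltW.
  have : b * s <= b * (q y + e) by rewrite ler_wpM2l// ltW.
  have : (a + b) * e = e by rewrite ab mul1r.
  by lra.
have Mepi h r : q h <= r -> M (h, r).
  move=> qr; apply: (Mmax [set z | q z.1 <= z.2]) => [[k t] /=|x y t s a b a0 b0 ab /= xt ys|t /=|//].
  - exact: qle.
  - by apply: le_trans (qcvx _ _ _ _ a0 b0 ab) _; rewrite lerD// ler_wpM2l.
  - exact: le_trans.
have q0 : q 0 = 0.
  apply/eqP; rewrite eq_le q0_ge0 andbT.
  suff /qle : M (0, 0) by [].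
  apply: (Mmax [set z | q z.1 <= z.2 + q 0]) => [[k t] /= /qle|x y t s a b a0 b0 ab /= xt ys|t /=|/=]; try lra.
  apply: le_trans (qcvx _ _ _ _ a0 b0 ab) _.
  have := ler_wpM2l a0 xt; have := ler_wpM2l b0 ys.
  have : (a + b) * q 0 = q 0 by rewrite ab mul1r.
  by lra.
have qZle (l : R) h : 0 < l -> l <= 1 -> q (l *: h) <= l * q h.
  move=> l0 l1; have := @qcvx h 0 l (1 - l).
  by rewrite q0 scaler0 addr0 mulr0 addr0; apply; lra.
have qZ1 (l : R) h : 0 < l -> l <= 1 -> q (l *: h) = l * q h.
  move=> l0 l1; apply/eqP; rewrite eq_le qZle//=.
  rewrite -ler_pdivlMl//; apply: (qle _ _).
  apply: (Mmax [set z | q (l *: z.1) <= l * z.2]) => [[k t] /= Mkt|x y t s a b a0 b0 ab /= xt ys|t /=|/=].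
  - by apply: le_trans (qZle l k l0 l1) _; rewrite ler_wpM2l ?(ltW l0)//; exact: qle.
  - rewrite scalerDr !scalerA ![l * _]mulrC -!scalerA.
    apply: le_trans (qcvx _ _ _ _ a0 b0 ab) _.
    have := ler_wpM2l a0 xt; have := ler_wpM2l b0 ys; lra.
  - by rewrite scaler0 q0 pmulr_rge0.
  - by rewrite mulVKf ?gt_eqF.
have qZ (l : R) h : 0 < l -> q (l *: h) = l * q h.
  move=> l0; have [l1|l1] := leP l 1; first exact: qZ1.
  rewrite -[in RHS](scalerK (lt0r_neq0 l0) h).
  by rewrite [in RHS]qZ1 ?invr_gt0 ?invf_le1// ?mulVKf// ?gt_eqF// ltW.
have qD h u : q (h + u) = q h + q u.
  apply/eqP; rewrite eq_le; apply/andP; split.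
    have := @qcvx h u 2^-1 2^-1; rewrite -scalerDr qZ ?invr_gt0//.
    have h2 : 0 <= 2^-1 :> R by lra.
    move=> /(_ h2 h2); lra.
  (* the competitor lies above h |-> inf over t >= 0 of q (h + t u) - t q u *)
  suff /qle : M (h, q (h + u) - q u) by lra.
  apply: (Mmax [set z | exists2 t, 0 <= t & q (z.1 + t *: u) <= z.2 + t * q u])
    => [[k t] /= /qle ?|x y t s a b a0 b0 ab /= [t1 t10 H1] [t2 t20 H2]|t /=|/=].
  - by exists 0 => //; rewrite scale0r addr0 mul0r addr0.
  - exists (a * t1 + b * t2); first by rewrite addr_ge0// mulr_ge0.
    have -> : a *: x + b *: y + (a * t1 + b * t2) *: u =
              a *: (x + t1 *: u) + b *: (y + t2 *: u).
      by rewrite scalerDl !scalerDr !scalerA addrACA.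
    apply: le_trans (qcvx _ _ _ _ a0 b0 ab) _.
    have := ler_wpM2l a0 H1; have := ler_wpM2l b0 H2; lra.
  - move=> [t1]; rewrite add0r le_eqVlt => /predU1P[<-|t10].
      by rewrite scale0r q0 mul0r addr0.
    by rewrite qZ//; lra.
  - by exists 1; rewrite // scale1r; lra.
have qN h : q (- h) = - q h by have := qD h (- h); rewrite subrr q0; lra.
have qlin : linear (q : V -> R^o).
  move=> l x y; rewrite qD; congr (_ + _); suff -> : q (l *: x) = l * q x by [].
  have [l0|l0|->] := ltgtP l 0.
  - by rewrite -[l]opprK scaleNr qN qZ ?oppr_gt0// !mulNr.
  - by rewrite qZ.
  - by rewrite scale0r q0 mul0r.
pose pM := GRing.isLinear.Build R V R^o *:%R (q : V -> R^o) qlin.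
pose p : {linear V -> R^o} := HB.pack (q : V -> R^o) pM.
by exists p => h r /AM /qle.
Qed.

(** * The Clarke-Rockafellar derivative *)

(** The inequality [cr_deriv f x h <= r] with its limits superior and infima
unfolded, see [cr_deriv_leP]. *)
Definition cr_bound {R : realType} {E : normedModType R} (f : E -> \bar R)
    (x h : E) (r : R) :=
  forall e r' : R, 0 < e -> r < r' -> exists2 rho, 0 < rho &
    forall y s t, `|x - y| < rho -> f y = s%:E -> `|fine (f x) - s| < rho ->
      0 < t -> t < rho ->
    exists2 b, `|b| <= 1 & (f (y + t *: (h + e *: b))%R <= (s + t * r')%R%:E)%E.

Lemma closed_unit_ballP {R : realType} {E : normedModType R} (b : E) :
  closed_ball (0 : E) 1 b <-> `|b| <= 1.
Proof. by rewrite closed_ballE// /closed_ball_ /= sub0r normrN. Qed.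

Lemma graph_nbhsP {R : realType} {E : normedModType R} {f : E -> \bar R} {x a} :
  f x = a%:E -> forall W, graph_nbhs f x W <-> exists2 rho, 0 < rho &
    forall y s, `|x - y| < rho -> f y = s%:E -> `|a - s| < rho -> W y.
Proof.
move=> fx W; split.
  move=> [[U V] /= [/nbhs_ballP[d1 /= d10 d1U]]]; rewrite fx => aV UVW.
  have /nbhs_ballP[d2 /= d20 d2V] : nbhs a (fun s => V s%:E) by [].
  exists (Num.min d1 d2); first by rewrite lt_min d10.
  move=> y s; rewrite !lt_min => /andP[xy _] fy /andP[_ as_]; apply: UVW; split.
    by apply: d1U; rewrite -ball_normE.
  by rewrite /= fy; apply: d2V; rewrite -ball_normE.
move=> [rho rho0 H].
exists (ball x rho, [set s%:E | s in ball a rho]) => /=.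
  split; first exact: nbhsx_ballx.
  rewrite fx; have : nbhs a (ball a rho) by exact: nbhsx_ballx.
  by apply: filterS => s as_; exists s.
move=> y [xy [s as_ fy]]; apply: (H y s) => //.
  by move: xy; rewrite -ball_normE.
Qed.

Lemma cr_deriv_leP {R : realType} {E : normedModType R} (f : E -> \bar R)
    x h r : f x \is a fin_num ->
  (cr_deriv f x h <= r%:E)%E <-> cr_bound f x h r.
Proof.
move=> fxfin; have fx : f x = (fine (f x))%:E by rewrite fineK.
split.
  move=> fr e r' e0 rr'.
  have : (cr_eps_deriv f e x h < r'%:E)%E.
    apply: (@le_lt_trans _ _ r%:E); last by rewrite lte_fin.
    by apply: le_trans fr; apply: ereal_sup_ubound; exists e.
  move=> /ereal_inf_lt[_ [W [[P Q] /= [xP Q0 PQW]] <-] supW].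
  have [rho1 rho10 H1] := (graph_nbhsP fx P).1 xP.
  have [rho2 /= rho20 H2] := Q0.
  exists (Num.min rho1 rho2); first by rewrite lt_min rho10.
  move=> y s t; rewrite !lt_min => /andP[xy _] fy /andP[as_ _] t0 /andP[_ tr].
  have Wyt : W (y, t).
    apply: PQW; split => /=; first exact: H1 as_.
    by apply: H2 => //=; rewrite sub0r normrN gtr0_norm.
  have : ((ereal_inf [set f (y + t *: (h + e *: b))%R | b in closed_ball (0 : E)%R 1%R]
        - f y) * (t^-1)%R%:E < r'%:E)%E.
    by apply: le_lt_trans supW; apply: ereal_sup_ubound; exists (y, t).
  rewrite lte_pdivrMr// fy lteBlDr//.
  rewrite -EFinM -EFinD => /ereal_inf_lt[_ [b /closed_unit_ballP b1 <-]] /ltW fb.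
  by exists b => //; have -> : s + t * r' = r' * t + s by ring.
move=> H; apply: ge_ereal_sup => _ [e /= e0 <-].
apply/lee_addgt0Pr => d d0.
have [rho rho0 H1] := H e (r + d) e0 (ltr_pwDr d0 (lexx r)).
pose W := [set y | exists s, [/\ `|x - y| < rho, f y = s%:E &
   `|fine (f x) - s| < rho]] `*` [set t | 0 < t /\ t < rho].
apply: ge_ereal_inf; eexists.
  exists W; last by [].
  exists ([set y | exists s, [/\ `|x - y| < rho, f y = s%:E &
     `|fine (f x) - s| < rho]], [set t | 0 < t /\ t < rho]); last by [].
  split => /=.
    by apply/(graph_nbhsP fx _); exists rho => // y s xy fy as_; exists s.
  exists rho => // t /=; rewrite sub0r normrN => t1 t0; split => //.
  by rewrite -[t]gtr0_norm.
apply: ge_ereal_sup => _ [[y t] [/= [s [xy fy as_]] [t0 tr]] <-].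
rewrite lee_pdivrMr// fy leeBlDr//.
have [b b1 fb] := H1 y s t xy fy as_ t0 tr.
apply: ge_ereal_inf; exists (f (y + t *: (h + e *: b))).
  by exists b => //; apply/closed_unit_ballP.
by rewrite -(EFinD r) -EFinM -EFinD; have -> : (r + d) * t + s = s + t * (r + d) by ring.
Qed.

(** To move from [y] by [t] in the direction [a u + b w], move first by [t a] in
the direction [u], then by [t b] in the direction [w].  The second move starts
at a point [y'] that must again be close to [x] with [f y'] close to [f x]:
the bound from the first move controls [f y'] from above, lower semicontinuity
at [x] controls it from below. *)
Lemma cr_bound_convex {R : realType} {E : normedModType R} (f : E -> \bar R) x :
  lower_semicontinuous f -> f x \is a fin_num ->
  convex_graph [set z | cr_bound f x z.1 z.2].
Proof.
move=> flsc fxfin u w r s a b /= a0 b0 ab ur ws.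
have [a_eq0|a_neq0] := eqVneq a 0.
  have -> : b = 1 by lra.
  by rewrite a_eq0 scale0r mul0r !add0r scale1r mul1r.
have [b_eq0|b_neq0] := eqVneq b 0.
  have -> : a = 1 by lra.
  by rewrite b_eq0 scale0r mul0r !addr0 scale1r mul1r.
have {a_neq0}a_gt0 : 0 < a by rewrite lt0r a_neq0.
have {b_neq0}b_gt0 : 0 < b by rewrite lt0r b_neq0.
move=> e r' e0 rr'; set d := r' - (a * r + b * s).
have d0 : 0 < d by rewrite subr_gt0.
have r'E : r' = a * (r + d) + b * (s + d).
  have : (a + b) * d = d by rewrite ab mul1r.
  by rewrite {2}/d; lra.
have [rho1 rho10 H1] := ur e (r + d) e0 (ltr_pwDr d0 (lexx r)).
have [rho2 rho20 H2] := ws e (s + d) e0 (ltr_pwDr d0 (lexx s)).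
have [V /nbhs_ballP[rho3 /= rho30 H3] VP] : exists2 V, nbhs x V &
    forall y, V y -> ((fine (f x) - rho2)%:E < f y)%E.
  by apply: flsc; rewrite -[ltRHS]fineK// lte_fin; lra.
(* chosen so that rho N = m bounds both |x - y'| and the increase of f *)
pose N := 1 + `|u| + e + `|r + d|.
have N1 : 1 <= N by rewrite /N -!addrA lerDl !addr_ge0// ltW.
pose m := Num.min rho1 (Num.min rho2 rho3).
have m0 : 0 < m by rewrite !lt_min rho10 rho20.
have [m1 [m2 m3]] : m <= rho1 /\ m <= rho2 /\ m <= rho3.
  by rewrite !ge_min !lexx !orbT.
have rhoN : m / N * N = m by rewrite divfK// gt_eqF// (lt_le_trans _ N1).
have rho0 : 0 < m / N by rewrite divr_gt0// (lt_le_trans _ N1).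
set rho := m / N in rhoN rho0; exists rho => // y s0 t xy fy fxs t0 trho.
have rhom : rho <= m by rewrite -rhoN ler_peMr// ltW.
have rhoS : rho + rho * `|u| + rho * e + rho * `|r + d| = m.
  by rewrite -rhoN /N; ring.
have ta : t * a <= t by rewrite ler_piMr//; lra.
have tb : t * b <= t by rewrite ler_piMr//; lra.
have ta0 : 0 < t * a by rewrite mulr_gt0.
have tb0 : 0 < t * b by rewrite mulr_gt0.
have rhou : 0 <= rho * `|u| by rewrite mulr_ge0// ltW.
have rhoe : 0 <= rho * e by rewrite mulr_ge0// ltW.
have rhor : 0 <= rho * `|r + d| by rewrite mulr_ge0// ltW.
have [b1 b11 fb1] : exists2 b1, `|b1| <= 1 &
    (f (y + (t * a) *: (u + e *: b1))%R <= (s0 + (t * a) * (r + d))%R%:E)%E.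
  by apply: (H1 y) => //; lra.
set y' := (y + (t * a) *: (u + e *: b1))%R in fb1.
have xy' : `|x - y'| < m.
  have -> : x - y' = (x - y) - (t * a) *: (u + e *: b1) by rewrite /y' opprD addrA.
  have : `|(t * a) *: (u + e *: b1)| <= rho * (`|u| + e).
    have ub1 : `|u + e *: b1| <= `|u| + e.
      rewrite (le_trans (ler_normD _ _))// lerD2l normrZ gtr0_norm//.
      by rewrite ler_piMr// ltW.
    rewrite normrZ gtr0_norm//; apply: ler_pM ub1 => //; first exact: ltW.
    by apply: le_trans ta _; exact: ltW.
  have := ler_normB (x - y) ((t * a) *: (u + e *: b1)); lra.
have fy'gt : ((fine (f x) - rho2)%:E < f y')%E.
  by apply: VP; apply: H3; rewrite -ball_normE /ball_ /=; lra.
have fy'fin : f y' \is a fin_num.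
  rewrite fin_numE; apply/andP; split; apply/eqP => fy'.
    by move: fy'gt; rewrite fy'.
  by move: fb1; rewrite fy'.
move: fb1 fy'gt; rewrite -[f y']fineK// lee_fin lte_fin => fb1 fy'gt.
have tar : t * a * (r + d) <= rho * `|r + d|.
  rewrite (le_trans (ler_norm _))// normrM gtr0_norm//.
  by rewrite ler_wpM2r//; lra.
have [b2 b21 fb2] : exists2 b2, `|b2| <= 1 &
    (f (y' + (t * b) *: (w + e *: b2))%R <= (fine (f y') + (t * b) * (s + d))%R%:E)%E.
  apply: (H2 y'); rewrite ?fineK//; try lra.
  by move: fxs; rewrite !ltr_norml => /andP[? ?]; apply/andP; split; lra.
exists (a *: b1 + b *: b2).
  rewrite (le_trans (ler_normD _ _))// !normrZ !gtr0_norm// -ab.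
  by rewrite lerD// ler_piMr// ltW.
have -> : y + t *: (a *: u + b *: w + e *: (a *: b1 + b *: b2)) =
    y' + (t * b) *: (w + e *: b2).
  rewrite /y' -[RHS]addrA; congr (_ + _); rewrite !scalerDr !scalerA addrACA.
  by congr (_ + _ *: _ + (_ + _ *: _)); ring.
by apply: le_trans fb2 _; rewrite lee_fin r'E; lra.
Qed.

(** * The Fermat rule for a convex perturbation *)

Definition convex_real {R : realType} {V : lmodType R} (phi : V -> R) :=
  forall x y (a b : R), 0 <= a -> 0 <= b -> a + b = 1 ->
    phi (a *: x + b *: y) <= a * phi x + b * phi y.

Lemma cr_bound0 {R : realType} {E : normedModType R} (f : E -> \bar R) x :
  cr_bound f x 0 0.
Proof.
move=> e r' e0 r'0; exists 1 => // y s t _ fy _ t0 _.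
exists 0; rewrite ?normr0// scaler0 !addr0 scaler0 addr0 fy lee_fin.
by rewrite lerDl mulr_ge0// ltW.
Qed.

(** Only the base point [y = v] of the limit superior is used.  Convexity of [phi]
compares its increment over the short step [t (h + e b)] with [t] times the
increment over the full step [h + e b]. *)
Lemma cr_bound_ge {R : realType} {E : normedModType R} (f : E -> \bar R)
    (phi : E -> R) v h r :
  f v \is a fin_num -> convex_real phi -> continuous phi ->
  (\forall u \near v, (f v + (phi v)%:E <= f u + (phi u)%:E)%E) ->
  cr_bound f v h r -> phi v - phi (v + h) <= r.
Proof.
move=> fvfin phicvx phicont /nbhs_ballP[k /= k0 kmin] fhr.
rewrite leNgt; apply/negP => rlt.
(* half of the gap pays for r' - r, half for the variation of phi near v + h *)
pose d := (phi v - phi (v + h) - r) / 2.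
have d0 : 0 < d by rewrite /d; lra.
have /cvgrPdist_lt/(_ _ d0)/nbhs_ballP[n /= n0 nP] := phicont (v + h).
have n20 : 0 < n / 2 by rewrite divr_gt0.
have [rho rho0 H] := fhr (n / 2) (r + d) n20 (ltr_pwDr d0 (lexx r)).
pose t := Num.min (rho / 2) (Num.min 1 (k / 2 / (`|h| + n / 2))).
have hn0 : 0 < `|h| + n / 2 by rewrite ltr_wpDl.
have t0 : 0 < t by rewrite !lt_min ltr01 !divr_gt0.
have [trho [t1 tk]] : t <= rho / 2 /\ t <= 1 /\ t <= k / 2 / (`|h| + n / 2).
  by rewrite !ge_min !lexx !orbT.
have [b b1 fb] : exists2 b, `|b| <= 1 &
    (f (v + t *: (h + (n / 2) *: b))%R <= (fine (f v) + t * (r + d))%R%:E)%E.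
  by apply: (H v); rewrite ?subrr ?normr0 ?fineK//; lra.
have nb : `|(n / 2) *: b| <= n / 2.
  by rewrite normrZ gtr0_norm// ler_piMr// ltW.
have phib : phi (v + h + (n / 2) *: b) < phi (v + h) + d.
  have /nP /= : ball (v + h) n (v + h + (n / 2) *: b).
    by rewrite -ball_normE /ball_ /= opprD addNKr normrN; lra.
  by rewrite ltr_norml; lra.
have vb : v + t *: (h + (n / 2) *: b) = (1 - t) *: v + t *: (v + h + (n / 2) *: b).
  by rewrite scalerBl scale1r -(addrA v h) (scalerDr t v) addrA subrK.
have := kmin (v + t *: (h + (n / 2) *: b)).
rewrite -ball_normE /ball_ /= opprD addNKr normrN => /(_ _)-/(_ _).
have tkk : `|t *: (h + (n / 2) *: b)| < k.
  rewrite normrZ gtr0_norm//.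
  have : t * (`|h| + n / 2) <= k / 2 by rewrite -ler_pdivlMr.
  have : t * `|h + (n / 2) *: b| <= t * (`|h| + n / 2).
    by rewrite ler_wpM2l ?(ltW t0)// (le_trans (ler_normD _ _))// lerD2l.
  by lra.
move=> /(_ tkk) fmin.
have := le_trans fmin (leeD fb (lexx _)).
rewrite -[f v]fineK// -!EFinD lee_fin vb.
have := phicvx v (v + h + (n / 2) *: b) (1 - t) t.
rewrite subr_ge0 t1 subrK => /(_ isT (ltW t0) erefl) phit fle.
have : t * (phi v) <= t * (r + d + phi (v + h + (n / 2) *: b)) by lra.
rewrite ler_pM2l//; rewrite /d in phib *; lra.
Qed.

(** The separating functional minorizes the epigraph of the infimal convolution
of the Clarke-Rockafellar derivative with [h |-> phi (v - h) - phi v]; by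
[cr_bound_ge] this convolution is nonnegative at [0]. *)
Lemma subdiff_local_min {R : realType} {E : normedModType R} (f : E -> \bar R)
    (phi : E -> R) v :
  lower_semicontinuous f -> f v \is a fin_num ->
  convex_real phi -> continuous phi ->
  (\forall u \near v, (f v + (phi v)%:E <= f u + (phi u)%:E)%E) ->
  exists2 p, subdiff f v p & forall u, phi v <= phi u + p (u - v).
Proof.
move=> flsc fvfin phicvx phicont fmin.
pose A := [set z : E * R | exists u r, cr_bound f v u r /\
  r + phi (v + u - z.1) - phi v <= z.2].
have Acvx : convex_graph A.
  move=> x y r s a b a0 b0 ab [u [q [uq /= xr]]] [w [q' [wq /= ys]]].
  exists (a *: u + b *: w), (a * q + b * q'); split => /=.
    exact: (cr_bound_convex _ _ flsc fvfin u w q q' a b a0 b0 ab).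
  have -> : v + (a *: u + b *: w) - (a *: x + b *: y) =
      a *: (v + u - x) + b *: (v + w - y).
    rewrite !scalerBr !scalerDr -{1}[v]scale1r -ab scalerDl opprD.
    by rewrite [RHS]addrACA; congr (_ + _); exact: addrACA.
  have := phicvx (v + u - x) (v + w - y) a b a0 b0 ab.
  have : (a + b) * phi v = phi v by rewrite ab mul1r.
  have := ler_wpM2l a0 xr; have := ler_wpM2l b0 ys; lra.
have A0 : nonneg_at0 A.
  move=> r [u [q [uq /=]]]; rewrite subr0.
  have := cr_bound_ge f phi v u q fvfin phicvx phicont fmin uq; lra.
have Aphi h : A (h, phi (v - h) - phi v).
  exists 0, 0; split; first exact: cr_bound0.
  by rewrite /= addr0 add0r.
have [|p pA] := convex_graph_linear_minorant A Acvx A0.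
  by move=> h; eexists; exact: Aphi.
exists p => [|u]; last by have := pA _ _ (Aphi (v - u)); rewrite subKr -opprB linearN /=; lra.
split; first by rewrite /edom /= ltey_eq fvfin.
  (* p h <= phi (v - h) - phi v, which is small for small h *)
  apply: bounded_linear_continuous.
  have /cvgrPdist_lt/(_ _ ltr01)/nbhs_ballP[k /= k0 kP] := phicont v.
  exists 1; split => // M M1.
  rewrite nbhs_nearE; apply/nbhs_ballP; exists k => // h.
  rewrite -ball_normE /ball_ /= sub0r normrN => hk.
  have ple g : `|g| < k -> p g <= 1.
    move=> gk; have := pA _ _ (Aphi g).
    have := kP (v - g); rewrite -ball_normE /ball_ /= subKr => /(_ gk).
    rewrite ltr_norml; lra.
  have := ple h hk; have := ple (- h); rewrite normrN linearN => /(_ hk) ? ?.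
  by apply: (le_trans _ (ltW M1)); rewrite ler_norml; lra.
move=> h; case Eh : (cr_deriv f v h) => [r| |].
- rewrite lee_fin; apply: pA; exists h, r; split => /=.
    by apply/cr_deriv_leP => //; rewrite Eh.
  by rewrite addrK; lra.
- by rewrite leey.
(* a derivative equal to -oo would put (h, r) in A for every r *)
- exfalso; have : (cr_deriv f v h <= (p h - 1)%:E)%E by rewrite Eh leNye.
  move=> /(cr_deriv_leP _ _ _ _ fvfin) ph.
  suff : p h <= p h - 1 by lra.
  by apply: pA; exists h, (p h - 1); split => //=; rewrite addrK; lra.
Qed.

(** * Ekeland's variational principle *)

(** The set [S z] of points that improve on [z] at rate [e] defines a preorder.
A sequence that at each step gets at least halfway down to the infimum of [G]
over [S z] is Cauchy, its limit belongs to every [S (s n)] by lower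
semicontinuity, and no point other than the limit improves on it. *)
Lemma ekeland {R : realType} {E : completeNormedModType R} (C : set E)
    (G : E -> \bar R) (m e : R) (x : E) :
  closed C -> lower_semicontinuous G -> (forall u, C u -> (m%:E <= G u)%E) ->
  0 < e -> C x -> G x \is a fin_num ->
  exists v, [/\ C v, (G v + (e * `|v - x|)%:E <= G x)%E &
    forall u, C u -> (G v <= G u + (e * `|u - v|)%:E)%E].
Proof.
move=> Cclosed Glsc Gm e0 Cx Gx.
pose g u := fine (G u); pose D u := C u /\ G u \is a fin_num.
pose S z u := C u /\ (G u + (e * `|u - z|)%:E <= G z)%E.
have SD z u : D z -> S z u -> D u.
  move=> [Cz Gz] [Cu Guz]; split => //; rewrite fin_numE; apply/andP; split.
    by apply/eqP => Gu; have := Gm u Cu; rewrite Gu.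
  by apply/eqP => Gu; move: Guz; rewrite Gu addye// leye_eq => /eqP Gzy; rewrite Gzy in Gz.
have gE u : D u -> G u = (g u)%:E by move=> [_ Gu]; rewrite /g fineK.
have Sg z u : D z -> S z u -> g u + e * `|u - z| <= g z.
  by move=> Dz Szu; have [_] := Szu; rewrite (gE z)// (gE u) ?lee_fin//; exact: SD Szu.
have Sgi z u : D z -> D u -> g u + e * `|u - z| <= g z -> S z u.
  move=> Dz Du gzu; split; first by case: Du.
  by rewrite (gE z)// (gE u)// -EFinD lee_fin.
have Sxx z : D z -> S z z by move=> Dz; apply: Sgi; rewrite // subrr normr0 mulr0 addr0.
have Strans y z u : D y -> S y z -> S z u -> S y u.
  move=> Dy yz zu; have Dz := SD _ _ Dy yz; have Du := SD _ _ Dz zu.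
  apply: Sgi => //; have := Sg _ _ Dy yz; have := Sg _ _ Dz zu.
  have : e * `|u - y| <= e * (`|u - z| + `|z - y|).
    by rewrite ler_wpM2l ?(ltW e0)// ler_distD.
  by lra.
have /choice[F FP] : forall z, exists w, D z -> S z w /\
    forall u, S z u -> 2 * g w <= g u + g z.
  move=> z.
  have [Dz|nDz] := pselect (D z); last by exists z.
  pose I := [set g u | u in S z].
  have Iinf : has_inf I.
    split; first by exists (g z); exists z => //; exact: Sxx.
    exists m => _ [u Szu <-]; have Du := SD _ _ Dz Szu.
    by rewrite -lee_fin -gE//; apply: Gm; case: Du.
  have iu u : S z u -> inf I <= g u.
    by move=> Szu; apply: ge_inf; [exact: Iinf.2|exists u].
  have [gi|gi] := leP (g z) (inf I).
    by exists z => _; split => [|u /iu]; [exact: Sxx|lra].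
  have d0 : 0 < (g z - inf I) / 2 by lra.
  have [_ [w Szw <-] wi] := inf_adherent d0 Iinf.
  by exists w => _; split => // u /iu; lra.
pose s n := iter n F x.
have Ds n : D (s n).
  by elim: n => [//|n Dn]; exact: SD (FP _ Dn).1.
have Ss n k : S (s n) (s (k + n)%N).
  elim: k => [|k IH]; first exact: Sxx.
  by apply: Strans IH _ => //; exact: (FP _ (Ds (k + n)%N)).1.
pose J := [set g (s n) | n in setT].
have Jinf : has_inf J.
  split; first by exists (g (s 0%N)); exists 0%N.
  exists m => _ [n _ <-]; rewrite -lee_fin -gE//; apply: Gm; by case: (Ds n).
have Jle n : inf J <= g (s n) by apply: ge_inf; [exact: Jinf.2|exists n].
have Jadh d : 0 < d -> exists n, g (s n) < inf J + d.
  by move=> d0; have [_ [n _ <-] ?] := inf_adherent d0 Jinf; exists n.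
have sCauchy d : 0 < d -> exists n, forall k, `|s (k + n)%N - s n| < d.
  move=> d0; have [n ng] := Jadh (e * d) (mulr_gt0 e0 d0); exists n => k.
  have := Sg _ _ (Ds n) (Ss n k); have := Jle (k + n)%N.
  by rewrite -(ltr_pM2l e0); lra.
have scvg : cvgn (s : nat -> E).
  apply: cauchy_cvg; apply: cauchy_exP => d d0.
  have [n nd] := sCauchy d d0; exists (s n).
  exists n => // k /= nk; rewrite -ball_normE /ball_ /= distrC.
  by rewrite -(subnK nk).
pose v := limn (s : nat -> E).
have sv : s @ \oo --> v := scvg.
have svd d : 0 < d -> forall N, exists2 k, (N <= k)%N & `|v - s k| < d.
  move=> d0 N; have /cvgrPdist_lt/(_ _ d0)[M _ MP] := sv.
  by exists (maxn N M); [exact: leq_maxl|apply: MP; exact: leq_maxr].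
have Cv : C v.
  apply: (closed_cvg C Cclosed _ v sv); apply: nearW => n; by case: (Ds n).
have Sv n : S (s n) v.
  split => //; rewrite (gE (s n))//.
  rewrite leNgt -lteBlDr//; apply/negP => /[dup] H.
  have [al al1 al2] : exists2 al, g (s n) - e * `|v - s n| < al & (al%:E < G v)%E.
    move: H; case: (G v) => [b| |] //; last by exists (g (s n) - e * `|v - s n| + 1); rewrite ?ltry// ltrDl.
    rewrite -EFinB lte_fin => ?; exists ((g (s n) - e * `|v - s n| + b) / 2).
      by lra.
    by rewrite lte_fin; lra.
  have [V /nbhs_ballP[k /= k0 kV] VG] := Glsc v al al2.
  pose d := Num.min k ((al - (g (s n) - e * `|v - s n|)) / e).
  have d0 : 0 < d by rewrite lt_min k0 divr_gt0// subr_gt0.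
  have [j nj] := svd d d0 n; rewrite lt_min ltr_pdivlMr// => /andP[jk jd] _.
  have : (al%:E < G (s j))%E by apply: VG; apply: kV; rewrite -ball_normE.
  rewrite gE// lte_fin.
  have := Sg _ _ (Ds n) (Ss n (j - n)%N); rewrite subnK//.
  have : e * `|v - s n| <= e * (`|v - s j| + `|s j - s n|).
    by rewrite ler_wpM2l ?(ltW e0)// ler_distD.
  by lra.
have Dv : D v := SD _ _ (Ds 0%N) (Sv 0%N).
have vJ : g v <= inf J.
  apply: lb_le_inf; first exact: Jinf.1.
  move=> _ [n _ <-]; have := Sg _ _ (Ds n) (Sv n).
  have : 0 <= e * `|v - s n| by rewrite mulr_ge0 ?(ltW e0).
  lra.
exists v; split => //; first by have [] := Sv 0%N.
move=> u Cu; rewrite leNgt; apply/negP => Guv.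
have Svu : S v u by split; last exact: ltW.
have Ju : inf J <= g u.
  apply/ler_addgt0Pr => d d0; have [n ng] := Jadh d d0.
  have := (FP _ (Ds n)).2 u (Strans _ _ _ (Ds n) (Sv n) Svu).
  have := Jle n.+1; rewrite /s /= -/(s n); lra.
have Du := SD _ _ Dv Svu.
move: Guv; rewrite (gE u)// (gE v)// -EFinD lte_fin.
have : 0 <= e * `|u - v| by rewrite mulr_ge0 ?(ltW e0).
  lra.
Qed.

(** * Perturbed minimizers carry subgradients *)

Lemma lower_semicontinuousD_cont {R : realType} {T : topologicalType}
    (f : T -> \bar R) (phi : T -> R) :
  lower_semicontinuous f -> continuous phi ->
  lower_semicontinuous (fun u => f u + (phi u)%:E)%E.
Proof.
move=> flsc phicont x a; rewrite -lteBlDr// -EFinB => afx.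
have [al aal /flsc[V xV VP]] : exists2 al, a - phi x < al & (al%:E < f x)%E.
  case: (f x) afx => [b| |] //; last by exists (a - phi x + 1); rewrite ?ltry// ltrDl.
  rewrite lte_fin => ?; exists ((a - phi x + b) / 2); first by lra.
  by rewrite lte_fin; lra.
have d0 : 0 < al - (a - phi x) by lra.
have /cvgrPdist_lt/(_ _ d0) phix := phicont x.
exists (V `&` [set u | `|phi x - phi u| < al - (a - phi x)]).
  exact: filterI.
move=> y [/VP aly /=]; rewrite ltr_norml => phiy.
by rewrite -lteBlDr// -EFinB (lt_trans _ aly)// lte_fin; lra.
Qed.

Lemma convex_realD {R : realType} {V : lmodType R} (phi psi : V -> R) :
  convex_real phi -> convex_real psi -> convex_real (fun u => phi u + psi u).
Proof.
move=> phicvx psicvx x y a b a0 b0 ab.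
have := phicvx x y a b a0 b0 ab; have := psicvx x y a b a0 b0 ab; lra.
Qed.

Lemma convex_realZ {R : realType} {V : lmodType R} (k : R) (phi : V -> R) :
  0 <= k -> convex_real phi -> convex_real (fun u => k * phi u).
Proof.
move=> k0 phicvx x y a b a0 b0 ab.
by have := ler_wpM2l k0 (phicvx x y a b a0 b0 ab); lra.
Qed.

Lemma convex_real_dist {R : realType} {E : normedModType R} (x : E) :
  convex_real (fun u => `|u - x|).
Proof.
move=> u w a b a0 b0 ab.
have -> : a *: u + b *: w - x = a *: (u - x) + b *: (w - x).
  by rewrite !scalerBr addrACA -opprD -scalerDl ab scale1r.
by rewrite (le_trans (ler_normD _ _))// !normrZ !ger0_norm.
Qed.

Lemma convex_real_sqr {R : realType} {V : lmodType R} (phi : V -> R) :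
  (forall u, 0 <= phi u) -> convex_real phi -> convex_real (fun u => phi u ^+ 2).
Proof.
move=> phi0 phicvx x y a b a0 b0 ab.
have : phi (a *: x + b *: y) ^+ 2 <= (a * phi x + b * phi y) ^+ 2.
  by rewrite ler_pXn2r ?nnegrE ?phi0 ?addr_ge0 ?mulr_ge0// phicvx.
move=> /le_trans; apply.
have -> : a * phi x ^+ 2 + b * phi y ^+ 2 =
    (a * phi x + b * phi y) ^+ 2 + a * b * (phi x - phi y) ^+ 2.
  have -> : b = 1 - a by lra.
  by ring.
by rewrite lerDl; apply: mulr_ge0; [exact: mulr_ge0|exact: sqr_ge0].
Qed.

Lemma continuous_dist {R : realType} {E : normedModType R} (x : E) :
  continuous (fun u => `|u - x|).
Proof.
by move=> u; apply: cvg_norm; apply: cvgB; [exact: cvg_id|exact: cvg_cst].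
Qed.

(** Ekeland's principle on a closed ball, followed by the Fermat rule for
[phi + e |. - v|] when the minimizer is interior. *)
Lemma perturbed_minimizer {R : realType} {E : completeNormedModType R}
    (f : E -> \bar R) (phi : E -> R) (a x : E) (r m e : R) :
  lower_semicontinuous f -> convex_real phi -> continuous phi ->
  (forall u, `|u - a| <= r -> (m%:E <= f u + (phi u)%:E)%E) ->
  0 < r -> 0 < e -> `|x - a| <= r -> f x \is a fin_num ->
  exists v, [/\ `|v - a| <= r, f v \is a fin_num,
    fine (f v) + phi v + e * `|v - x| <= fine (f x) + phi x &
    `|v - a| < r -> exists2 p, subdiff f v p &
      forall u, phi v <= phi u + e * `|u - v| + p (u - v)].
Proof.
move=> flsc phicvx phicont fm r0 e0 xr fx.
have inC u : closed_ball a r u <-> `|u - a| <= r.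
  by rewrite closed_ballE// /closed_ball_ /= distrC.
have Gx : (f x + (phi x)%:E)%E \is a fin_num by rewrite fin_numD fx.
have [v [/inC va vx vmin]] := ekeland (closed_ball a r)
  (fun u => f u + (phi u)%:E)%E m e x (@closed_ball_closed _ _ a r)
  (lower_semicontinuousD_cont f phi flsc phicont) (fun u Cu => fm u ((inC u).1 Cu))
  e0 ((inC x).2 xr) Gx.
have fv : f v \is a fin_num.
  move: vx (fm v va) Gx => /=; case: (f v) => // [+ _].
  by rewrite !addye// leye_eq => /eqP ->.
exists v; split => //.
  by move: vx; rewrite -(fineK fv) -(fineK fx) -!EFinD lee_fin.
move=> var.
have psicvx : convex_real (fun u => phi u + e * `|u - v|).
  apply: convex_realD => //; apply: convex_realZ; first exact: ltW.
  exact: convex_real_dist.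
have psicont : continuous (fun u => phi u + e * `|u - v|).
  move=> u; apply: cvgD; first exact: phicont.
  by apply: cvgMr; exact: continuous_dist.
have [|p pf pmin] := subdiff_local_min f (fun u => phi u + e * `|u - v|) v flsc fv psicvx psicont.
  apply/nbhs_ballP; exists (r - `|v - a|); first by rewrite /= subr_gt0.
  move=> u; rewrite -ball_normE /ball_ /= => uv.
  have ua : `|u - a| <= r.
    by have := ler_distD v u a; rewrite (distrC u v); lra.
  rewrite subrr normr0 mulr0 addr0 EFinD addeA; apply: vmin.
  exact/inC.
exists p => // u; have := pmin u; rewrite subrr normr0 mulr0; lra.
Qed.

Lemma subdiff_fin_num {R : realType} {E : normedModType R} (f : E -> \bar R) x p :
  (forall x, f x <> -oo%E) -> subdiff f x p -> f x \is a fin_num.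
Proof.
move=> fNy [fx _ _]; rewrite fin_numE; apply/andP; split; apply/eqP; first exact: fNy.
by move=> fxy; move: fx; rewrite /edom /= fxy ltxx.
Qed.

(** Minimize [f + M |. - x|] near [x] for large [M]: the minimizer [v] cannot
leave a small ball around [x], where [f] is bounded below. *)
Lemma subdiff_dense {R : realType} {E : completeNormedModType R} (f : E -> \bar R)
    (x : E) (eta : R) :
  lower_semicontinuous f -> f x \is a fin_num -> 0 < eta ->
  exists v p, [/\ subdiff f v p, `|v - x| < eta, f v \is a fin_num &
    fine (f v) <= fine (f x)].
Proof.
move=> flsc fx eta0.
have [V /nbhs_ballP[d /= d0 dV] VP] : exists2 V, nbhs x V &
    forall y, V y -> ((fine (f x) - 1)%:E < f y)%E.
  by apply: flsc; rewrite -[ltRHS]fineK// lte_fin; lra.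
pose r := Num.min (d / 2) (eta / 2).
have r0 : 0 < r by rewrite lt_min !divr_gt0.
have [rd re] : r <= d / 2 /\ r <= eta / 2 by rewrite !ge_min !lexx orbT.
have rr : 2 / r * r = 2 by rewrite divfK// gt_eqF.
have K0 : 0 < 2 / r by rewrite divr_gt0.
have fxge u : `|u - x| <= r -> ((fine (f x) - 1)%:E <= f u)%E.
  by move=> ur; apply/ltW/VP/dV; rewrite -ball_normE /ball_ /= distrC; lra.
(* M = 2 / r with f x - f <= 1 on the ball keeps v in its interior *)
pose phi u := 2 / r * `|u - x|.
have phicvx : convex_real phi.
  by apply: convex_realZ; [exact: ltW|exact: convex_real_dist].
have phicont : continuous phi by move=> u; apply: cvgMr; exact: continuous_dist.
have phim u : `|u - x| <= r -> ((fine (f x) - 1)%:E <= f u + (phi u)%:E)%E.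
  move=> ur; rewrite -[leLHS]adde0; apply: leeD; first exact: fxge.
  by rewrite lee_fin mulr_ge0// ltW.
have xr : `|x - x| <= r by rewrite subrr normr0 ltW.
have [v [vr fv vle vp]] := perturbed_minimizer f phi x x r _ 1
  flsc phicvx phicont phim r0 ltr01 xr fx.
rewrite /phi subrr normr0 mulr0 addr0 mul1r in vle.
have vx0 : 0 <= 2 / r * `|v - x| by rewrite mulr_ge0// ltW.
have := fxge v vr; rewrite -[f v]fineK// lee_fin => fvge.
have vxr : `|v - x| < r.
  by rewrite -(ltr_pM2l K0) rr; have := normr_ge0 (v - x); lra.
have [p pv _] := vp vxr.
by exists v, p; split => //; have := normr_ge0 (v - x); lra.
Qed.

Lemma subdiff_bounded {R : realType} {E : normedModType R} (f : E -> \bar R) x p :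
  subdiff f x p -> exists2 N, 0 <= N & forall h, `|p h| <= N * `|h|.
Proof.
move=> [_ pcont _].
have /linear_boundedP[N [Nreal NP]] := continuous_linear_bounded 0 (pcont 0).
exists (`|N| + 1) => [|h]; first by rewrite addr_ge0.
by apply: NP; rewrite (le_lt_trans (ler_norm N))// ltrDl.
Qed.

(** * Proximal chains *)

Lemma plr_fine {R : realType} {E : normedModType R} {f : E -> \bar R}
    {c delta : R} {x0 x y : E} {p : {linear E -> R^o}} (N : R) :
  plr c delta f x0 -> 0 <= c -> ball x0 delta x -> ball x0 delta y ->
  subdiff f x p -> f x \is a fin_num -> f y \is a fin_num ->
  0 <= N -> (forall h, `|p h| <= N * `|h|) ->
  fine (f x) + p (y - x) - c * (1 + N) * `|y - x| ^+ 2 <= fine (f y).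
Proof.
move=> fplr c0 xd yd pf fx fy N0 pN.
have := fplr x y xd yd p pf.
rewrite -(fineK fx) -(fineK fy) -(EFinD (fine (f x))) -EFinB lee_fin; apply: le_trans.
rewrite lerB// -!mulrA ler_wpM2l// ler_wpM2r ?sqr_ge0// lerD2l.
apply: ge_sup.
  by exists `|p 0|; exists 0 => //; apply/closed_unit_ballP; rewrite normr0.
move=> _ [h /closed_unit_ballP h1 <-].
by rewrite (le_trans (pN h))// ler_piMr.
Qed.

Lemma ge0_limit0 {R : realType} (A B : R) :
  (forall t, 0 < t -> t <= 1 -> 0 <= A + t * B) -> 0 <= A.
Proof.
move=> H; rewrite leNgt; apply/negP => A0.
pose t := Num.min 1 (- A / 2 / (`|B| + 1)).
have B1 : 0 < `|B| + 1 by rewrite ltr_wpDl.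
have t0 : 0 < t by rewrite lt_min ltr01 !divr_gt0// oppr_gt0.
have [t1 tA] : t <= 1 /\ t <= - A / 2 / (`|B| + 1) by rewrite !ge_min !lexx orbT.
have : t * (`|B| + 1) <= - A / 2 by rewrite -ler_pdivlMr.
have : t * B <= t * `|B| by rewrite ler_pM2l// ler_norm.
have := H t t0 t1; lra.
Qed.

(** One step of the chain.  The subgradient [p] is the negative of a subgradient
of [K |. - a| + |. - x|^2 / (2 lam) + e |. - v|] at [v].  The two lower bounds on
[p] come from moving by [t h] for small [t]: the first for a general direction,
the second for [h = x - v], where [|v + t h - x|] is exactly
[(1 - t) |v - x|] and one gains [|v - x|^2 / lam]. *)
Lemma proximal_step {R : realType} {E : completeNormedModType R}
    (f : E -> \bar R) (a x : E) (r m K lam e : R) :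
  lower_semicontinuous f -> (forall u, `|u - a| <= r -> (m%:E <= f u)%E) ->
  0 < r -> 0 <= K -> 0 < lam -> 0 < e -> `|x - a| <= r -> f x \is a fin_num ->
  exists v, [/\ `|v - a| <= r, f v \is a fin_num,
    `|v - x| ^+ 2 / (2 * lam) <=
      (fine (f x) + K * `|x - a|) - (fine (f v) + K * `|v - a|) &
    `|v - a| < r -> exists p, [/\ subdiff f v p,
      forall h, - (K * (`|v + h - a| - `|v - a|) + (`|v - x| / lam + e) * `|h|)
        <= p h &
      K * (`|v - a| - `|x - a|) + `|v - x| ^+ 2 / lam - e * `|v - x|
        <= p (x - v)]].
Proof.
move=> flsc fm r0 K0 lam0 e0 xr fx.
pose k := (2 * lam)^-1; have k0 : 0 < k by rewrite invr_gt0 mulr_gt0.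
have kE : lam^-1 = 2 * k by rewrite /k invfM mulVKf.
pose phi u := K * `|u - a| + k * `|u - x| ^+ 2.
have phicvx : convex_real phi.
  apply: convex_realD; apply: convex_realZ => //; first exact: convex_real_dist.
    exact: ltW.
  by apply: convex_real_sqr => //; exact: convex_real_dist.
have phicont : continuous phi.
  move=> u; apply: cvgD; apply: cvgMr; first exact: continuous_dist.
  by apply: cvgM; exact: continuous_dist.
have phim u : `|u - a| <= r -> (m%:E <= f u + (phi u)%:E)%E.
  move=> ur; rewrite -[leLHS]adde0; apply: leeD; first exact: fm.
  by rewrite lee_fin addr_ge0// mulr_ge0 ?sqr_ge0// ltW.
have [v [vr fv vle vp]] := perturbed_minimizer f phi a x r m e
  flsc phicvx phicont phim r0 e0 xr fx.
have dx u : `|u - x| ^+ 2 / (2 * lam) = k * `|u - x| ^+ 2 by rewrite mulrC.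
exists v; split => //.
  move: vle; rewrite /phi subrr normr0 expr0n /= dx.
  have : 0 <= e * `|v - x| by rewrite mulr_ge0// ltW.
  lra.
move=> /vp[p pf pmin].
have cvxa h t : 0 < t -> t <= 1 ->
    `|v + t *: h - a| <= (1 - t) * `|v - a| + t * `|v + h - a|.
  move=> t0 t1; have -> : v + t *: h = (1 - t) *: v + t *: (v + h).
    by rewrite scalerBl scale1r scalerDr addrA subrK.
  by apply: convex_real_dist; rewrite ?subr_ge0 ?subrK// ltW.
have pt h t : 0 < t -> t <= 1 ->
    k * `|v - x| ^+ 2 <= t * (K * (`|v + h - a| - `|v - a|) + e * `|h| + p h) +
      k * `|v + t *: h - x| ^+ 2.
  move=> t0 t1; have := pmin (v + t *: h).
  have -> : v + t *: h - v = t *: h by rewrite addrC addKr.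
  rewrite /phi linearZ /= normrZ gtr0_norm//.
  have := ler_wpM2l K0 (cvxa h t t0 t1); rewrite /GRing.scale /=; lra.
exists p; split => // [h|].
  have : 0 <= K * (`|v + h - a| - `|v - a|) + e * `|h| + p h
      + `|v - x| / lam * `|h|.
    apply: (@ge0_limit0 _ _ (k * `|h| ^+ 2)) => t t0 t1.
    rewrite -(pmulr_rge0 _ t0); have := pt h t t0 t1.
    have : k * `|v + t *: h - x| ^+ 2 <= k * (`|v - x| + t * `|h|) ^+ 2.
      rewrite ler_pM2l// ler_pXn2r ?nnegrE ?addr_ge0// ?mulr_ge0 ?(ltW t0)//.
      by rewrite addrAC (le_trans (ler_normD _ _))// normrZ gtr0_norm.
    rewrite kE; lra.
  lra.
have : 0 <= K * (`|x - a| - `|v - a|) + e * `|v - x| + p (x - v)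
    - `|v - x| ^+ 2 / lam.
  apply: (@ge0_limit0 _ _ (k * `|v - x| ^+ 2)) => t t0 t1.
  rewrite -(pmulr_rge0 _ t0); have := pt (x - v) t t0 t1.
  have -> : v + t *: (x - v) - x = (1 - t) *: (v - x).
    by rewrite scalerBl scale1r addrAC -(opprB v x) scalerN.
  rewrite normrZ ger0_norm ?subr_ge0// subrKC (distrC x v) kE; lra.
by lra.
Qed.
(** The energy balance of one step of length [d] that follows a step of length
[s].  The error terms are multiples of [d^2], which is at most [2 lam FF]. *)
Lemma step_energy_arith {R : realType} (lam e c K D s d FF GG : R) :
  0 < lam -> 0 <= e -> 0 <= c -> 0 <= K -> 0 <= s -> s <= D -> 0 <= d -> d <= D ->
  d ^+ 2 / (2 * lam) <= FF ->
  FF <= (s / lam + e) * d + c * (1 + (K + s / lam + e)) * d ^+ 2 ->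
  d ^+ 2 / lam - e * d - c * (1 + (K + d / lam + e)) * d ^+ 2 <= GG ->
  FF - GG <= (s ^+ 2 - d ^+ 2) / (2 * lam) + 2 * e * d +
    (2 * lam * c * (2 + 2 * K + 2 * e) + 4 * c * D) * FF.
Proof.
move=> lam0 e0 c0 K0 s0 sD d0 dD; set k := (2 * lam)^-1.
have k0 : 0 < k by rewrite invr_gt0 mulr_gt0.
have kE : lam^-1 = 2 * k by rewrite /k invfM mulVKf.
have klam : 2 * lam * k = 1 by rewrite mulfV// mulf_neq0// lt0r_neq0.
rewrite kE => dFF FFle GGge.
have FF0 : 0 <= FF by apply: le_trans dFF; rewrite mulr_ge0 ?sqr_ge0// ltW.
(* Young's inequality in the form s d - d^2 <= (s^2 - d^2) / 2 *)
have young : 0 <= k * (s - d) ^+ 2 by rewrite mulr_ge0 ?sqr_ge0// ltW.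
have d2 : d ^+ 2 <= 2 * lam * FF.
  have : 2 * lam * (d ^+ 2 * k) <= 2 * lam * FF by rewrite ler_pM2l// mulr_gt0.
  have -> : 2 * lam * (d ^+ 2 * k) = (2 * lam * k) * d ^+ 2 by ring.
  by rewrite klam mul1r.
have err1 : c * (2 + 2 * K + 2 * e) * d ^+ 2 <= c * (2 + 2 * K + 2 * e) * (2 * lam * FF).
  by rewrite ler_wpM2l// mulr_ge0// !addr_ge0// mulr_ge0.
have err2 : c * (s + d) * (d ^+ 2 * k) <= c * (D + D) * FF.
  apply: ler_pM => //; rewrite ?mulr_ge0 ?addr_ge0 ?sqr_ge0//; first exact: ltW.
  by rewrite ler_wpM2l// lerD.
lra.
Qed.

(** The energy estimate along a chain from [x] down to [a], by induction on a
bound [M] for the number of steps.  A step that does not end at [a] has length at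
least [lam], hence lowers [F] by at least [lam / 2] and absorbs its Ekeland error
[2 e d] into [4 e (F x - F v)]; only the last step leaves an error proportional to
[e r].  The length [s] of the preceding step enters through the bound that it
leaves on the subgradient [p]; an initial point fits the same format with [s]
equal to [lam] times a bound on the size of [p].  The bound [T < (K - C) r] keeps
the chain in the interior of the ball around [a]. *)
Lemma descent_comparison {R : realType} {E : completeNormedModType R}
    (f g : E -> \bar R) (c delta : R) (x0 a : E) (r C K lam e D T : R) :
  (forall x, f x <> -oo%E) -> (forall x, g x <> -oo%E) -> lower_semicontinuous f ->
  plr c delta f x0 -> plr c delta g x0 ->
  (forall x, ball x0 delta x -> subdiff f x = subdiff g x) ->
  (forall u, `|u - a| <= r -> ball x0 delta u) ->
  f a \is a fin_num ->
  (forall u, `|u - a| <= r -> ((fine (f a) - C * `|u - a|)%:E <= f u)%E) ->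
  0 < c -> 0 < r -> c * r <= 1 / 4 -> 0 <= C -> 2 * C + 5 <= K ->
  0 < lam -> 0 < e -> e <= 1 -> 0 <= D -> 2 * lam * T <= D ^+ 2 -> T < (K - C) * r ->
  let F u := fine (f u) + K * `|u - a| in
  let G u := fine (g u) + K * `|u - a| in
  let theta := 4 * e + (2 * lam * c * (2 + 2 * K + 2 * e) + 4 * c * D) in
  forall M x p s, `|x - a| <= r -> subdiff f x p ->
    (forall h, - (K * (`|x + h - a| - `|x - a|) + (s / lam + e) * `|h|) <= p h) ->
    0 <= s -> s <= D -> F x - F a <= T -> F x - F a <= M%:R * (lam / 2) ->
    F x - F a - (G x - G a) <= s ^+ 2 / (2 * lam) + theta * (F x - F a) + 4 * e * r.
Proof.
move=> fNy gNy flsc fplr gplr subE inball fa fC c0 r0 cr C0 CK lam0 e0 e1 D0 lamT TK.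
move=> F G theta.
have K0 : 0 <= K by lra.
have KC : 0 < K - C by lra.
have klam0 : 0 < 2 * lam by rewrite mulr_gt0.
have Fge u : `|u - a| <= r -> f u \is a fin_num -> (K - C) * `|u - a| <= F u - F a.
  move=> ur fu; have := fC u ur; rewrite -[f u]fineK// lee_fin /F subrr normr0; lra.
have pbound x (p : {linear E -> R^o}) s : 0 <= s ->
    (forall h, - (K * (`|x + h - a| - `|x - a|) + (s / lam + e) * `|h|) <= p h) ->
    forall h, `|p h| <= (K + s / lam + e) * `|h|.
  move=> s0 ps.
  have half h : - ((K + s / lam + e) * `|h|) <= p h.
    apply: le_trans (ps h); have := ler_normD (x - a) h.
    rewrite addrAC => /(ler_wpM2l K0); lra.
  move=> h; rewrite ler_norml half /=; have := half (- h).
  by rewrite normrN linearN lerNl opprK.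
have slam s : 0 <= s -> 0 <= s / lam by move=> s0; rewrite divr_ge0// ltW.
elim=> [|M IH] x p s xr pf ps s0 sD FT FM.
  have fx := subdiff_fin_num f x p fNy pf.
  have := Fge x xr fx; rewrite mul0r in FM => Fx.
  have /eqP : `|x - a| = 0.
    apply/eqP; rewrite eq_le normr_ge0 andbT -(@pmulr_rle0 _ (K - C))//; lra.
  rewrite normr_eq0 subr_eq0 => /eqP ->; rewrite !subrr mulr0 addr0.
  by rewrite addr_ge0 ?divr_ge0 ?sqr_ge0// ?mulr_ge0// ltW.
have fx := subdiff_fin_num f x p fNy pf.
have gx : g x \is a fin_num.
  by apply: (subdiff_fin_num g x p gNy); rewrite -subE//; exact: inball.
have fm u : `|u - a| <= r -> ((fine (f a) - C * r)%:E <= f u)%E.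
  move=> ur; apply: le_trans (fC u ur); rewrite lee_fin lerB//.
  by rewrite ler_wpM2l.
have [v [vr fv vF vp]] := proximal_step f a x r _ K lam e flsc fm r0 K0 lam0 e0 xr fx.
have {}vr : `|v - a| < r.
  rewrite -(ltr_pM2l KC); apply: le_lt_trans (Fge v vr fv) _.
  have : 0 <= `|v - x| ^+ 2 / (2 * lam) by rewrite divr_ge0 ?sqr_ge0// ltW.
  rewrite /F in FT TK *; lra.
have [q [qf qs qx]] := vp vr.
set d := `|v - x| in vF qs qx.
have d0 : 0 <= d by exact: normr_ge0.
have qg : subdiff g v q by rewrite -subE//; exact: inball (ltW vr).
have gv := subdiff_fin_num g v q gNy qg.
have xB := inball x xr; have vB := inball v (ltW vr).
have aB : ball x0 delta a by apply: inball; rewrite subrr normr0 ltW.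
have vFG : d ^+ 2 / (2 * lam) <= F x - F v by [].
have Fva := Fge v (ltW vr) fv.
have KCv : 0 <= (K - C) * `|v - a| by rewrite mulr_ge0// ltW.
have dD : d <= D.
  rewrite -(@ler_pXn2r _ 2)// ?nnegrE//; apply: le_trans lamT.
  by move: vFG; rewrite ler_pdivrMr// mulrC => /le_trans; apply; rewrite ler_pM2l//; lra.
have pN := pbound x p s s0 ps.
have qN := pbound v q d d0 qs.
have Ns : 0 <= K + s / lam + e by have := slam s s0; lra.
have Nd : 0 <= K + d / lam + e by have := slam d d0; lra.
have Fle : F x - F v <= (s / lam + e) * d + c * (1 + (K + s / lam + e)) * d ^+ 2.
  have := plr_fine _ fplr (ltW c0) xB vB pf fx fv Ns pN.
  have := ps (v - x); rewrite subrKC -/d /F; lra.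
have Gge : d ^+ 2 / lam - e * d - c * (1 + (K + d / lam + e)) * d ^+ 2 <= G x - G v.
  have := plr_fine _ gplr (ltW c0) vB xB qg gv gx Nd qN.
  rewrite distrC -/d /G; lra.
have step := step_energy_arith lam e c K D s d (F x - F v) (G x - G v) lam0 (ltW e0)
  (ltW c0) K0 s0 sD d0 dD vFG Fle Gge.
have FxFv : 0 <= F x - F v by apply: le_trans vFG; rewrite divr_ge0 ?sqr_ge0// ltW.
have [va|va] := eqVneq v a.
  have da : d <= r by rewrite /d va distrC.
  have ed : 2 * e * d <= 2 * e * r by rewrite ler_pM2l// mulr_gt0.
  have er : 0 <= e * r by rewrite mulr_ge0// ltW.
  have eF : 0 <= e * (F x - F v) by rewrite mulr_ge0// ltW.
  have dlam : 0 <= d ^+ 2 / (2 * lam) by rewrite divr_ge0 ?sqr_ge0// ltW.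
  by rewrite va in step eF; rewrite /theta; lra.
have rho0 : 0 < `|v - a| by rewrite normr_gt0 subr_eq0.
(* lower regularity between v and a, divided by |v - a|: the term K wins as
   c |v - a| <= 1 / 4 *)
have dlam : 1 <= d / lam.
  have := plr_fine _ fplr (ltW c0) vB aB qf fv fa Nd qN.
  have := qs (a - v); rewrite subrKC subrr normr0 sub0r.
  rewrite (distrC a v) => qa fav.
  set rho := `|v - a| in rho0 qa fav *.
  have crho : c * rho <= 1 / 4 by apply: le_trans cr; rewrite ler_pM2l// ltW.
  have : 0 <= rho * (C - K + (d / lam + e) + c * rho * (1 + (K + d / lam + e))).
    have := Fge v (ltW vr) fv; rewrite /F subrr normr0 -/rho; lra.
  rewrite pmulr_rge0// => H.
  rewrite leNgt; apply/negP => dl.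
  have : c * rho * (1 + (K + d / lam + e)) <= 1 / 4 * (1 + (K + d / lam + e)).
    by rewrite ler_wpM2r//; lra.
  lra.
have dlam' : lam <= d by move: dlam; rewrite ler_pdivlMr// mul1r.
have d2 : d <= 2 * (F x - F v).
  have : d * 1 <= d * (d / lam) by rewrite ler_wpM2l.
  have -> : d * (d / lam) = 2 * (d ^+ 2 / (2 * lam)) by field; rewrite gt_eqF.
  lra.
have lam2 : lam / 2 <= F x - F v.
  by lra.
have ed : e * d <= e * (2 * (F x - F v)) by rewrite ler_pM2l.
have := IH v q d (ltW vr) qf qs d0 dD.
have -> : F v - F a <= T by lra.
have -> : F v - F a <= M%:R * (lam / 2) by move: FM; rewrite -natr1; lra.
move=> /(_ isT isT); rewrite /theta; lra.
Qed.

(** * Integration of the subdifferential *)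

(** Apply [descent_comparison] with [e = D = eta] and [lam] of order [eta^2]:
every error term is then at most a constant times [eta], and [eta] tends to [0]. *)
Lemma subdiff_increment_le {R : realType} {E : completeNormedModType R}
    (f g : E -> \bar R) (c delta : R) (x0 a x : E) (r : R) (pa px : {linear E -> R^o}) :
  (forall x, f x <> -oo%E) -> (forall x, g x <> -oo%E) -> lower_semicontinuous f ->
  plr c delta f x0 -> plr c delta g x0 ->
  (forall x, ball x0 delta x -> subdiff f x = subdiff g x) ->
  (forall u, `|u - a| <= r -> ball x0 delta u) ->
  0 < c -> 0 < r -> c * r <= 1 / 4 ->
  subdiff f a pa -> subdiff f x px -> `|x - a| < r ->
  fine (f x) - fine (f a) <= fine (g x) - fine (g a).
Proof.
move=> fNy gNy flsc fplr gplr subE inball c0 r0 cr paf pxf xar.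
have aB : ball x0 delta a by apply: inball; rewrite subrr normr0 ltW.
have fa := subdiff_fin_num f a pa fNy paf.
have fx := subdiff_fin_num f x px fNy pxf.
have [Na Na0 paN] := subdiff_bounded f a pa paf.
have [Nx Nx0 pxN] := subdiff_bounded f x px pxf.
(* the rate at which f may decrease away from a, by regularity at a *)
pose C := Na + c * (1 + Na) * r.
have cNa0 : 0 <= c * (1 + Na) by rewrite mulr_ge0 ?(ltW c0)// addr_ge0.
have C0 : 0 <= C by rewrite addr_ge0// mulr_ge0// ltW.
have fC u : `|u - a| <= r -> ((fine (f a) - C * `|u - a|)%:E <= f u)%E.
  move=> ur; case fu : (f u) => [b| |]; [|by rewrite leey|by have := fNy u].
  have := plr_fine Na fplr (ltW c0) aB (inball u ur) paf fa; rewrite fu /=.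
  move=> /(_ isT Na0 paN); rewrite lee_fin.
  have := paN (u - a); rewrite ler_norml => /andP[+ _].
  have : `|u - a| * `|u - a| <= r * `|u - a| by rewrite ler_wpM2r.
  by move=> /(ler_wpM2l cNa0); rewrite /C; lra.
have rx0 : 0 < r - `|x - a| by rewrite subr_gt0.
(* K1 makes the total descent T small enough for the chain to stay in the ball *)
pose K1 := (`|fine (f x) - fine (f a)| + C * r + 1) / (r - `|x - a|).
have Cr0 : 0 <= C * r by rewrite mulr_ge0// ltW.
have K10 : 0 <= K1 by rewrite divr_ge0 ?(ltW rx0)// !addr_ge0.
pose K := 2 * C + 5 + K1.
have K0 : 0 <= K by rewrite !addr_ge0// mulr_ge0.
have CK : 2 * C + 5 <= K by rewrite lerDl.
pose T := fine (f x) - fine (f a) + K * `|x - a|.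
have TK : T < (K - C) * r.
  have : K1 * (r - `|x - a|) = `|fine (f x) - fine (f a)| + C * r + 1.
    by rewrite divfK// gt_eqF.
  have : K1 * (r - `|x - a|) <= K * (r - `|x - a|).
    by rewrite ler_wpM2r ?(ltW rx0)// lerDr addr_ge0// mulr_ge0.
  have := ler_norm (fine (f x) - fine (f a)); rewrite /T; lra.
have T0 : 0 <= T.
  have := fC x (ltW xar); rewrite -[f x]fineK// lee_fin.
  have : C * `|x - a| <= K * `|x - a| by rewrite ler_wpM2r//; lra.
  rewrite /T; lra.
(* lam s0 plays the role of the step preceding x *)
pose s0 := K + Nx; have s00 : 0 <= s0 by rewrite addr_ge0.
pose Q := 1 + 2 * T + s0 + s0 ^+ 2.
have Q1 : 1 <= Q by rewrite /Q -!addrA lerDl !addr_ge0 ?sqr_ge0// mulr_ge0.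
have Q0 : 0 < Q by lra.
pose B := 1 + (4 + 2 * c * (4 + 2 * K) + 4 * c) * T + 4 * r.
suff : 0 <= (fine (g x) - fine (g a) - (fine (f x) - fine (f a))) by lra.
apply: (@ge0_limit0 _ _ B) => eta eta0 eta1.
pose lam := eta ^+ 2 / Q.
have lam0 : 0 < lam by rewrite divr_gt0// exprn_gt0.
have lamQ : lam * Q = eta ^+ 2 by rewrite divfK// gt_eqF.
have eta2 : eta ^+ 2 <= eta by rewrite expr2 ler_piMr// ltW.
have lams : lam * s0 <= eta.
  apply: le_trans eta2; rewrite -lamQ ler_pM2l// /Q.
  by have := sqr_ge0 s0; lra.
have lams2 : lam * s0 ^+ 2 <= eta.
  by apply: le_trans eta2; rewrite -lamQ ler_pM2l// /Q; lra.
have lameta : lam <= eta.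
  by apply: le_trans eta2; rewrite -lamQ -[leLHS]mulr1 ler_pM2l.
have lamT : 2 * lam * T <= eta ^+ 2.
  by rewrite -lamQ [2 * _]mulrC -mulrA ler_pM2l// /Q; have := sqr_ge0 s0; lra.
have ss0 : 0 <= lam * s0 by rewrite mulr_ge0// ltW.
have ps h : - (K * (`|x + h - a| - `|x - a|) + (lam * s0 / lam + eta) * `|h|) <= px h.
  have -> : lam * s0 / lam = s0 by rewrite mulrC mulKf// gt_eqF.
  have := pxN h; rewrite ler_norml => /andP[+ _].
  have xh : `|x - a| - `|h| <= `|x + h - a|.
    have := ler_normD (x + h - a) (- h); rewrite normrN.
    have -> : x + h - a - h = x - a by rewrite addrAC addrK.
    lra.
  have := ler_wpM2l K0 xh; have : 0 <= eta * `|h| by rewrite mulr_ge0// ltW.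
  rewrite /s0; lra.
have [M MT] : exists M : nat, T <= M%:R * (lam / 2).
  exists (Num.bound (T / (lam / 2))).
  have lam20 : 0 < lam / 2 by rewrite divr_gt0.
  by rewrite -ler_pdivrMr// ltW// archi_boundP// divr_ge0// ltW.
have FT : fine (f x) + K * `|x - a| - (fine (f a) + K * `|a - a|) = T.
  by rewrite subrr normr0 /T; ring.
have := @descent_comparison _ _ f g c delta x0 a r C K lam eta eta T fNy gNy flsc
  fplr gplr subE inball fa fC c0 r0 cr C0 CK lam0 eta0 eta1 (ltW eta0) lamT TK
  M x px (lam * s0) (ltW xar) pxf ps ss0 lams.
rewrite FT lexx => /(_ isT MT).
have -> : fine (g x) + K * `|x - a| - (fine (g a) + K * `|a - a|) =
    fine (g x) - fine (g a) + K * `|x - a| by rewrite subrr normr0; ring.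
have -> : (lam * s0) ^+ 2 / (2 * lam) = lam * s0 ^+ 2 / 2.
  by field; rewrite gt_eqF.
have thetaT : (4 * eta + (2 * lam * c * (2 + 2 * K + 2 * eta) + 4 * c * eta)) * T <=
    eta * (4 + 2 * c * (4 + 2 * K) + 4 * c) * T.
  rewrite ler_wpM2r//.
  have : lam * (2 * c * (2 + 2 * K + 2 * eta)) <= eta * (2 * c * (4 + 2 * K)).
    apply: ler_pM => //; first exact: ltW.
      by rewrite !mulr_ge0 ?(ltW c0)// !addr_ge0// ?mulr_ge0// ltW.
    by apply: ler_wpM2l; [rewrite mulr_ge0// ltW|lra].
  lra.
have TE : T = fine (f x) - fine (f a) + K * `|x - a| by [].
rewrite /B; lra.
Qed.

(** If [g x] were larger, lower semicontinuity would keep [g] above that value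
near [x], while [subdiff_dense] yields nearby points [v] with a subgradient and
[f v <= f x], where the increments of [f] and [g] from [a] are comparable. *)
Lemma plr_le_shift {R : realType} {E : completeNormedModType R}
    (f g : E -> \bar R) (c delta : R) (x0 a : E) (r : R) (pa : {linear E -> R^o}) :
  (forall x, f x <> -oo%E) -> (forall x, g x <> -oo%E) ->
  lower_semicontinuous f -> lower_semicontinuous g ->
  plr c delta f x0 -> plr c delta g x0 ->
  (forall x, ball x0 delta x -> subdiff f x = subdiff g x) ->
  (forall u, `|u - a| <= r -> ball x0 delta u) ->
  0 < c -> 0 < r -> c * r <= 1 / 4 -> subdiff f a pa ->
  forall x, `|x - a| < r -> f x \is a fin_num ->
  (g x <= (fine (f x) - fine (f a) + fine (g a))%:E)%E.
Proof.
move=> fNy gNy flsc glsc fplr gplr subE inball c0 r0 cr paf x xar fx.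
rewrite leNgt; apply/negP => /glsc[V /nbhs_ballP[d /= d0 dV] VP].
pose eta := Num.min d (r - `|x - a|).
have eta0 : 0 < eta by rewrite lt_min d0 subr_gt0.
have [v [p [pf vx fv fvx]]] := subdiff_dense f x eta flsc fx eta0.
move: vx; rewrite lt_min => /andP[vxd vxr].
have var : `|v - a| < r by have := ler_distD x v a; lra.
have aB : ball x0 delta a by apply: inball; rewrite subrr normr0 ltW.
have vB := inball v (ltW var).
have subE' y : ball x0 delta y -> subdiff g y = subdiff f y.
  by move=> yB; rewrite subE.
have gv : g v \is a fin_num by apply: (subdiff_fin_num g v p gNy); rewrite -subE.
have : ((fine (f x) - fine (f a) + fine (g a))%:E < g v)%E.
  by apply: VP; apply: dV; rewrite -ball_normE /ball_ /= distrC.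
have pag : subdiff g a pa by rewrite -subE.
have pg : subdiff g v p by rewrite -subE.
have := subdiff_increment_le g f c delta x0 a v r pa p gNy fNy glsc gplr fplr subE'
  inball c0 r0 cr pag pg var.
rewrite -[g v]fineK// lte_fin; lra.
Qed.

Theorem theorem2 (R : realType) (E : completeNormedModType R)
    (f g : E -> \bar R)
    (f_neqNy : forall x, f x <> -oo%E) (g_neqNy : forall x, g x <> -oo%E)
    (f_proper : proper_fun f) (g_proper : proper_fun g)
    (f_lsc : lower_semicontinuous f) (g_lsc : lower_semicontinuous g)
    (c delta : R) (c_gt0 : 0 < c) (delta_gt0 : 0 < delta)
    (x0 : E) (x0_in : (plr c delta f `&` plr c delta g `&` edom f) x0)
    (subdiff_eq : forall x, ball x0 delta x -> subdiff f x = subdiff g x) :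
  exists a : R, forall x,
    ball x0 (Num.min (delta / 2) (1 / (18 * c))) x -> f x = (g x + a%:E)%E.
Proof.
have [[fplr gplr] fx0] := x0_in.
set h := Num.min _ _.
have h0 : 0 < h by rewrite lt_min !divr_gt0// mulr_gt0.
have [hd hc] : h <= delta / 2 /\ h <= 1 / (18 * c) by rewrite !ge_min !lexx orbT.
have f0 : f x0 \is a fin_num.
  rewrite fin_numE; apply/andP; split; apply/eqP; first exact: f_neqNy.
  by move=> fx0y; move: fx0; rewrite /edom /= fx0y ltxx.
(* a lies within h / 4 of x0, so the ball of radius 5 h / 4 around a covers the
   ball of radius h around x0 and stays within 3 h / 2 < delta of x0 *)
have h40 : 0 < h / 4 by rewrite divr_gt0.
have [a [pa [paf ax fa _]]] := subdiff_dense f x0 (h / 4) f_lsc f0 h40.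
pose r := h * (5 / 4).
have r0 : 0 < r by rewrite mulr_gt0// divr_gt0.
have cr : c * r <= 1 / 4.
  have ch : h * (18 * c) <= 1 by rewrite -ler_pdivlMr// mulr_gt0.
  by rewrite /r; lra.
have inball u : `|u - a| <= r -> ball x0 delta u.
  move=> ur; rewrite -ball_normE /ball_ /= distrC.
  by have := ler_distD a u x0; rewrite /r in ur; lra.
have aB : ball x0 delta a by apply: inball; rewrite subrr normr0 ltW.
have subE' y : ball x0 delta y -> subdiff g y = subdiff f y.
  by move=> yB; rewrite subdiff_eq.
have pag : subdiff g a pa by rewrite subE'.
have gf x : `|x - a| < r -> f x \is a fin_num ->
    (g x <= (fine (f x) - fine (f a) + fine (g a))%:E)%E.
  exact: (plr_le_shift f g c delta x0 a r pa).
have fg x : `|x - a| < r -> g x \is a fin_num ->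
    (f x <= (fine (g x) - fine (g a) + fine (f a))%:E)%E.
  exact: (plr_le_shift g f c delta x0 a r pa).
exists (fine (f a) - fine (g a)) => x.
rewrite -ball_normE /ball_ /= => xh.
have xar : `|x - a| < r.
  by have := ler_distD x0 x a; rewrite (distrC x x0) (distrC x0 a) /r; lra.
case fx : (f x) => [b| |]; last by have := f_neqNy x.
  have := gf x xar; rewrite fx => /(_ isT) /=.
  case gx : (g x) => [b'| |] //; last by have := g_neqNy x.
  have := fg x xar; rewrite gx fx => /(_ isT) /=.
  by rewrite !lee_fin => ? ?; rewrite -EFinD; congr (_%:E); lra.
case gx : (g x) => [b'| |] //; last by have := g_neqNy x.
by have := fg x xar; rewrite gx fx => /(_ isT); rewrite leye_eq.
Qed.
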